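(* For $n\ge1$ let $L_n(x)=\sum_{k}L(n,k)x^k$ and $W_n(x)=\sum_k W(n,k)x^k$, and set $L_0(x)=W_0(x)=1$. Then $$\sum_{n\ge0}L_n(x)\frac{t^n}{n!}=\exp\Big(\sum_{n\ge0}W_n(x)\frac{t^{n+1}}{(n+1)!}\Big).$$
   Context: For a permutation $\sigma=\sigma_1\cdots\sigma_n$ of $[n]$: a left peak is an index $i$ with $1\le i\le n-1$ and $\sigma_{i-1}<\sigma_i>\sigma_{i+1}$, with $\sigma_0=0$; an exterior peak is an index $i$ with $1\le i\le n$ and $\sigma_{i-1}<\sigma_i>\sigma_{i+1}$, with $\sigma_0=\sigma_{n+1}=0$. $L(n,k)$ (resp. $W(n,k)$) is the number of permutations of $[n]$ with exactly $k$ left peaks (resp. exterior peaks). *)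

(* Defs.v *)
From mathcomp Require Import all_boot all_order all_fingroup all_algebra.
Set Implicit Arguments.
Unset Strict Implicit.
Unset Printing Implicit Defensive.
Import GRing.Theory.
Local Open Scope ring_scope.

(* A permutation s of 'I_n is read as the word s_1 ... s_n in the letters
   1, ..., n: positions and values are both shifted by one from 'I_n.
   Outside 1 <= i <= n the letter is 0, so s_0 = s_(n+1) = 0. *)
Definition letter (n : nat) (s : 'S_n) (i : nat) : nat :=
  if i is j.+1 then
    if insub j is Some j' then (s (j' : 'I_n)).+1 else 0%N
  else 0%N.

Definition peak_at (n : nat) (s : 'S_n) (i : nat) : bool :=
  (letter s i.-1 < letter s i)%N && (letter s i.+1 < letter s i)%N.

(* Here 1 <= i < n. *)
Definition left_peaks (n : nat) (s : 'S_n) : seq nat :=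
  [seq i <- index_iota 1 n | peak_at s i].

(* Here 1 <= i <= n. *)
Definition exterior_peaks (n : nat) (s : 'S_n) : seq nat :=
  [seq i <- index_iota 1 n.+1 | peak_at s i].

Definition L (n k : nat) : nat := #|[set s : 'S_n | size (left_peaks s) == k]|.

Definition W (n k : nat) : nat :=
  #|[set s : 'S_n | size (exterior_peaks s) == k]|.

(* A permutation of [n] has at most n peaks of either kind, so the sums over
   all k stop at k = n. *)
Definition Lpoly (n : nat) : {poly rat} :=
  if n is 0 then 1 else \sum_(k < n.+1) (L n k)%:R *: 'X^k.

Definition Wpoly (n : nat) : {poly rat} :=
  if n is 0 then 1 else \sum_(k < n.+1) (W n k)%:R *: 'X^k.

(* Formal power series in t over Q[x]: F n is the coefficient of t^n. *)
Definition fps : Type := nat -> {poly rat}.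

Definition fps_one : fps := fun n => (n == 0%N)%:R.

Definition fps_mul (F G : fps) : fps :=
  fun n => \sum_(i < n.+1) F i * G (n - i)%N.

Definition fps_pow (F : fps) (k : nat) : fps := iter k (fps_mul F) fps_one.

(* exp(F) = \sum_(k >= 0) F^k / k!, for F with zero constant term.  The
   coefficient of t^n in F^k is then 0 for k > n (lemma fps_pow_coef0), so only
   k <= n contributes to the coefficient of t^n. *)
Definition fps_exp (F : fps) : fps :=
  fun n => \sum_(k < n.+1) (k`!%:R)^-1 *: fps_pow F k n.

Lemma fps_pow_coef0 (F : fps) (k n : nat) :
  F 0%N = 0 -> (n < k)%N -> fps_pow F k n = 0.
Proof.
move=> F0; elim: k n => [|k IHk] n //= lt_nk.
rewrite /fps_mul big1 // => -[[|i] /= lt_in] _; first by rewrite F0 mul0r.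
rewrite -/(fps_pow F k) IHk ?mulr0 //.
case: n lt_nk lt_in => // n lt_nk lt_in.
by rewrite subSS; apply: leq_ltn_trans (leq_subr _ _) _.
Qed.

(* \sum_(n >= 0) L_n(x) t^n / n! *)
Definition Lseries : fps := fun n => (n`!%:R)^-1 *: Lpoly n.

(* \sum_(n >= 0) W_n(x) t^(n+1) / (n+1)!; its constant term is 0. *)
Definition Wseries : fps :=
  fun n => if n is m.+1 then ((m.+1)`!%:R)^-1 *: Wpoly m else 0.

(* Main.v *)
(** Inserting the letter [n.+1] into a word of [n] letters creates one peak and
    destroys the peak adjacent to the chosen gap, if there is one; each peak is
    adjacent to exactly two gaps, and no gap is adjacent to two peaks.  With
    [D f = 2x(1-x)f'] this gives
    [W_(n+1) = (n+1)x W_n + D W_n] and [L_(n+1) = L_n + n x L_n + D L_n]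
    (for left peaks, the last gap neither creates nor destroys a peak).  As [D]
    is a derivation, these two recurrences and Pascal's rule imply
    [L_(n+1) = \sum_i C(n,i) W_i L_(n-i)] by induction, which is the coefficient
    form of the equation [G' = F' G] that characterizes [G = exp F]. *)

Require Import Defs.
From mathcomp Require Import all_boot all_order all_fingroup all_algebra.
From mathcomp Require Import ring zify.
Set Implicit Arguments.
Unset Strict Implicit.
Unset Printing Implicit Defensive.
Import GRing.Theory Num.Theory.
Local Open Scope ring_scope.

#[local] Arguments Lpoly : simpl never.
#[local] Arguments Wpoly : simpl never.

(** * Peaks of a word and insertion of a dominating letter *)

Definition word_peak (w : nat -> nat) (j : nat) : bool :=
  (w j.-1 < w j)%N && (w j.+1 < w j)%N.

Definition peaks_below (w : nat -> nat) (m : nat) : nat :=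
  (\sum_(1 <= j < m) word_peak w j)%N.

(* The new letter sits at position [i.+1], in the gap between the positions
   [i] and [i.+1] of [w]. *)
Definition insert_letter (w : nat -> nat) (i M : nat) (j : nat) : nat :=
  if (j <= i)%N then w j else if j == i.+1 then M else w j.-1.

(** For [i < m], these are the peaks destroyed by an insertion into gap [i]; the guards keep to the
    positions [1, ..., m - 1] that [peaks_below w m] counts. *)
Definition adjacent_peaks (w : nat -> nat) (m i : nat) : nat :=
  ((0 < i)%N && word_peak w i + (i.+1 < m)%N && word_peak w i.+1)%N.

Lemma word_peak_succ w i : word_peak w i -> word_peak w i.+1 = false.
Proof. by case/andP=> _ h; rewrite /word_peak /= ltnNge ltnW. Qed.

Lemma adjacent_peaks_le1 w m i : (adjacent_peaks w m i <= 1)%N.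
Proof.
rewrite /adjacent_peaks; case: (boolP (word_peak w i)) => [/word_peak_succ ->|_].
  by rewrite andbF addn0 leq_b1.
by rewrite andbF add0n leq_b1.
Qed.

Lemma sum_adjacent_peaks w m :
  (\sum_(0 <= i < m) adjacent_peaks w m i = (peaks_below w m).*2)%N.
Proof.
rewrite -addnn big_split /= /peaks_below; congr addn; case: m => [|m].
- by rewrite !big_geq.
- rewrite big_nat_recl //= add0n big_add1 /=.
  by apply: eq_bigr => i _.
- by rewrite !big_geq.
rewrite big_nat_recr //= ltnn addn0 big_add1 /= big_nat [RHS]big_nat.
by apply: eq_bigr => i; rewrite ltnS => /andP[_ ->].
Qed.

Lemma word_peak_insert_letter w i M j :
  (forall l, w l < M)%N -> (0 < j)%N ->
  word_peak (insert_letter w i M) j =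
    if (j < i)%N then word_peak w j
    else if (j == i) || (j == i.+2) then false
    else if j == i.+1 then true
    else word_peak w j.-1.
Proof.
move=> ltM j_gt0; set v := insert_letter w i M.
have v_lo l : (l <= i)%N -> v l = w l by rewrite /v /insert_letter => ->.
have v_mid : v i.+1 = M by rewrite /v /insert_letter ltnn eqxx.
have v_hi l : (i < l)%N -> v l.+1 = w l.
  by move=> lt_il; rewrite /v /insert_letter !ifF //; lia.
rewrite /word_peak.
case: (ltngtP j i) => [lt_ji|lt_ij|->] /=.
- by rewrite !v_lo //; lia.
- case: (j =P i.+2) => [->|ne2] /=.
    by rewrite v_mid v_hi // ltnNge (ltnW (ltM _)).
  case: (j =P i.+1) => [->|ne1] /=; first by rewrite v_lo // v_mid v_hi ?ltM.
  case: j j_gt0 lt_ij ne1 ne2 => // -[|j] _; first by lia.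
  by move=> lt_ij ne1 ne2; rewrite /= !v_hi //; lia.
- by rewrite v_mid (v_lo i) // (ltnNge M) (ltnW (ltM i)) andbF.
Qed.

Lemma peaks_below_insert_letter w i M m :
  (forall l, w l < M)%N -> (i < m)%N ->
  (peaks_below (insert_letter w i M) m.+1 + adjacent_peaks w m i
   = (peaks_below w m).+1)%N.
Proof.
move=> ltM lt_im.
(* [A] and [B] count the peaks on the left and on the right that survive; those at [i] and [i.+1]
   give way to the single peak at the new letter. *)
pose A := (\sum_(1 <= j < i) word_peak w j)%N.
pose B := (\sum_(i.+2 <= j < m) word_peak w j)%N.
have pe := word_peak_insert_letter i ltM.
have -> : peaks_below w m = (A + adjacent_peaks w m i + B)%N.
  rewrite /peaks_below /adjacent_peaks.
  have e1 : (\sum_(1 <= j < i.+1) word_peak w j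
             = A + ((0 < i)%N && word_peak w i))%N.
    rewrite /A; case: (i) => [|k]; first by rewrite !big_geq.
    by rewrite big_nat_recr.
  rewrite (big_cat_nat (n := i.+1)) //= e1 addnA -[RHS]addnA; congr (_ + _)%N.
  rewrite /B; have [lt|ge] := ltnP i.+1 m; first by rewrite big_ltn.
  by rewrite !big_geq // ltnW.
have -> : peaks_below (insert_letter w i M) m.+1 = (A + 1 + B)%N.
  rewrite /peaks_below (big_cat_nat (n := i.+1)) //=; last by rewrite ltnW // ltnS.
  rewrite -addnA; congr (_ + _)%N.
    rewrite /A; case: (i) pe => [|k] pe; first by rewrite !big_geq.
    rewrite big_nat_recr //= pe // ltnn eqxx /= addn0 big_nat [RHS]big_nat.
    by apply: eq_bigr => j /andP[j0 lt]; rewrite pe // lt.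
  rewrite big_ltn ?ltnS // pe // ltnNge leqnSn /= !eqn_leq ltnn leqnn /=.
  rewrite leqnSn ltnn /=; congr (_ + _)%N.
  rewrite /B; have [lt|ge] := ltnP i.+1 m; last by rewrite !big_geq // ltnW.
  rewrite big_ltn // pe // ltnNge leqW ?leqnSn //= eqxx orbT add0n big_add1 /=.
  rewrite big_nat [RHS]big_nat; apply: eq_bigr => j /andP[lj _]; rewrite pe //.
  have -> : (j.+1 < i)%N = false by lia.
  have -> : (j.+1 == i) = false by lia.
  have -> : (j.+1 == i.+2) = false by lia.
  by have -> : (j.+1 == i.+1) = false by lia.
lia.
Qed.

(** With [p] peaks, [2p] gaps keep the exponent [p] and the other [m - 2p] raise it by one. Writing
    [p] as the effect of [X d/dX] makes the result linear in ['X^p], so it can be summed over all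
    permutations. *)
Lemma sum_insert_letter w M m : (forall l, w l < M)%N ->
  \sum_(i < m) 'X^(peaks_below (insert_letter w i M) m.+1) =
  (m%:R * 'X) * 'X^(peaks_below w m)
    + ((1 - 'X) *+ 2 * 'X) * 'X^(peaks_below w m)^`() :> {poly rat}.
Proof.
move=> ltM; set p := peaks_below w m.
have Xderiv : 'X * 'X^p^`() = 'X^p *+ p :> {poly rat}.
  by rewrite derivXn; case: (p) => [|q]; rewrite ?mulr0n ?mulr0 // mulrnAr -exprS.
have term (i : 'I_m) : 'X^(peaks_below (insert_letter w i M) m.+1)
    = 'X * 'X^p + (adjacent_peaks w m i)%:R * ((1 - 'X) * 'X^p) :> {poly rat}.
  have := peaks_below_insert_letter ltM (ltn_ord i); rewrite -/p.
  case: adjacent_peaks (adjacent_peaks_le1 w m i) => [|[|//]] _.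
    by rewrite addn0 => ->; rewrite exprS mul0r addr0.
  by rewrite addn1 => -[->]; ring.
rewrite (eq_bigr _ (fun i _ => term i)) big_split /= sumr_const card_ord.
rewrite -mulr_suml -natr_sum -(big_mkord xpredT (adjacent_peaks w m)).
rewrite sum_adjacent_peaks -/p -[(_ *+ 2) * 'X * _]mulrA Xderiv -mul2n natrM.
ring.
Qed.

(** * Insertion of the largest letter into a permutation *)

Lemma letter_le n (s : 'S_n) j : (letter s j <= n)%N.
Proof. by case: j => //= j; case: insub => [k|] //=; apply: ltn_ord. Qed.

Lemma letter_ord n (s : 'S_n) (j : 'I_n) : letter s j.+1 = (s j).+1.
Proof. by rewrite /letter valK. Qed.

Lemma letter_out n (s : 'S_n) j : (n <= j)%N -> letter s j.+1 = 0%N.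
Proof. by move=> le_nj; rewrite /letter insubF // ltnNge le_nj. Qed.

Lemma letter_lift_perm n (s : 'S_n) (i : 'I_n.+1) j :
  letter (lift_perm i ord_max s) j = insert_letter (letter s) i n.+1 j.
Proof.
case: j => [|j] //; rewrite /insert_letter.
have lt_in := ltn_ord i; have [lt_nj|le_jn] := ltnP n j.
  rewrite letter_out //.
  have -> : (j < i)%N = false by lia.
  have -> : (j.+1 == i.+1) = false by lia.
  by case: j lt_nj => // j lt_nj; rewrite letter_out.
pose k := Ordinal (le_jn : (j < n.+1)%N).
rewrite -[j]/(nat_of_ord k) letter_ord.
case: (unliftP i k) => [l ek|->]; last by rewrite lift_perm_id ltnn eqxx.
rewrite ek lift_perm_lift [_ (lift ord_max (s l))]lift_max.
rewrite [nat_of_ord (lift i l)]/(bump i l).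
rewrite /bump; have [le_il|lt_li] := leqP i l; last first.
  by rewrite add0n lt_li letter_ord.
rewrite add1n eqSS letter_ord.
have -> : (l.+1 < i)%N = false by lia.
by have -> : (l.+1 == i) = false by lia.
Qed.

Lemma peaks_below_lift_perm n (s : 'S_n) (i : 'I_n.+1) m :
  peaks_below (letter (lift_perm i ord_max s)) m
  = peaks_below (insert_letter (letter s) i n.+1) m.
Proof. by apply: eq_bigr => j _; rewrite /word_peak !letter_lift_perm. Qed.

(** Inserting the largest letter is injective, since its position recovers the gap, and bijective
    because [(n+1)! = (n+1) n!]. *)
Lemma sum_perm_lift (V : nmodType) n (f : 'S_n.+1 -> V) :
  \sum_(s : 'S_n.+1) f s
  = \sum_(s : 'S_n) \sum_(i < n.+1) f (lift_perm i ord_max s).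
Proof.
pose h (p : 'S_n * 'I_n.+1) := lift_perm p.2 ord_max p.1.
have h_inj : injective h.
  move=> [s i] [s' i'] /= eq_h.
  have eh k : lift_perm i ord_max s k = lift_perm i' ord_max s' k.
    by move: eq_h; rewrite /h /= => ->.
  have ei : i = i'.
    by apply: (@perm_inj _ (lift_perm i' ord_max s')); rewrite -eh !lift_perm_id.
  rewrite -{}ei in eh *; congr pair; apply/permP => k.
  by apply: (@lift_inj _ ord_max); rewrite -!(lift_perm_lift i) eh.
have h_bij : bijective h.
  apply: inj_card_bij h_inj _.
  by rewrite card_prod card_ord !card_Sn factS mulnC.
rewrite pair_big /= (reindex h) //=.
exact: onW_bij.
Qed.

(** * The polynomials as sums over permutations *)

Lemma size_filter_peaks n (s : 'S_n) m :
  size [seq i <- index_iota 1 m | peak_at s i] = peaks_below (letter s) m.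
Proof. by rewrite size_filter -sum1_count big_mkcond. Qed.

Lemma peaks_below_le w m : (peaks_below w m <= m.-1)%N.
Proof.
rewrite -subn1 -[X in (_ <= X)%N]muln1 -sum_nat_const_nat.
by apply: leq_sum => j _; apply: leq_b1.
Qed.

Lemma sum_card_Xn n (f : 'S_n -> nat) : (forall s, f s <= n)%N ->
  \sum_(k < n.+1) (#|[set s | f s == k]|)%:R *: 'X^k
  = \sum_(s : 'S_n) 'X^(f s) :> {poly rat}.
Proof.
move=> f_le; pose g s : 'I_n.+1 := inord (f s).
have gE s : g s = f s :> nat by rewrite inordK // ltnS.
rewrite [RHS](partition_big g xpredT) //=; apply: eq_bigr => k _.
rewrite (eq_bigr (fun=> 'X^k)) => [|s /eqP <-]; last by rewrite gE.
rewrite sumr_const scaler_nat; congr (_ *+ _).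
by apply: eq_card => s; rewrite inE -gE.
Qed.

Lemma sum_perm0 (f : 'S_0 -> {poly rat}) :
  (forall s, f s = 1) -> \sum_s f s = 1.
Proof.
move=> f1; rewrite (eq_bigr _ (fun s _ => f1 s)) sumr_const.
by rewrite card_Sn.
Qed.

(** Left and exterior peaks differ only in the bound, [n] or [n.+1], so one insertion lemma serves
    both. The empty permutation yields the convention for [n = 0]. *)
Lemma LpolyE n : Lpoly n = \sum_(s : 'S_n) 'X^(peaks_below (letter s) n).
Proof.
case: n => [|n].
  by rewrite sum_perm0 // => s; rewrite /peaks_below big_geq.
rewrite -sum_card_Xn => [|s]; last first.
  exact: leq_trans (peaks_below_le _ _) (leqnSn _).
apply: eq_bigr => k _; congr (_%:R *: _).
by apply: eq_card => s; rewrite !inE size_filter_peaks.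
Qed.

Lemma WpolyE n : Wpoly n = \sum_(s : 'S_n) 'X^(peaks_below (letter s) n.+1).
Proof.
case: n => [|n].
  by rewrite sum_perm0 // => s; rewrite /peaks_below big_geq.
rewrite -sum_card_Xn => [|s]; last exact: peaks_below_le.
apply: eq_bigr => k _; congr (_%:R *: _).
by apply: eq_card => s; rewrite !inE size_filter_peaks.
Qed.

(** * Recurrences and the binomial convolution *)

Lemma Wpoly_rec n :
  Wpoly n.+1 = (n.+1%:R * 'X) * Wpoly n + ((1 - 'X) *+ 2 * 'X) * (Wpoly n)^`().
Proof.
rewrite !WpolyE sum_perm_lift raddf_sum !mulr_sumr -big_split.
apply: eq_bigr => s _ /=.
rewrite -(@sum_insert_letter _ n.+1) => [|l]; last by rewrite ltnS letter_le.
by apply: eq_bigr => i _; rewrite peaks_below_lift_perm.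
Qed.

Lemma Lpoly_rec n :
  Lpoly n.+1 = Lpoly n + (n%:R * 'X) * Lpoly n
               + ((1 - 'X) *+ 2 * 'X) * (Lpoly n)^`().
Proof.
rewrite !LpolyE sum_perm_lift raddf_sum !mulr_sumr -!big_split.
(* The last gap [i = n] is split off: there position [n] precedes the new letter and position [n.+1]
   is not counted, so the left peaks are unchanged. The other [n] gaps fall under
   [sum_insert_letter] with [m = n]. *)
apply: eq_bigr => s _ /=; rewrite big_ord_recr /=.
have ltM l : (letter s l < n.+1)%N by rewrite ltnS letter_le.
rewrite -addrA -(sum_insert_letter _ ltM) addrC; congr (_ + _).
  rewrite peaks_below_lift_perm; congr ('X^_).
  rewrite /peaks_below; case: n s ltM => [|n] s ltM; first by rewrite !big_geq.
  rewrite big_nat_recr //= word_peak_insert_letter // ltnn eqxx /= addn0.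
  rewrite big_nat [RHS]big_nat; apply: eq_bigr => j /andP[j0 lt_jn].
  by rewrite word_peak_insert_letter // lt_jn.
by apply: eq_bigr => i _; rewrite peaks_below_lift_perm.
Qed.

Lemma sum_binomialS (V : nmodType) (f : nat -> V) n :
  \sum_(i < n.+2) f i *+ 'C(n.+1, i)
  = \sum_(i < n.+1) (f i.+1 + f i) *+ 'C(n, i).
Proof.
rewrite big_ord_recl bin0 /=.
rewrite (eq_bigr (fun i : 'I_n.+1 => f i.+1 *+ 'C(n, i.+1) + f i.+1 *+ 'C(n, i))).
  rewrite big_split /= addrA addrC.
  rewrite [in RHS](eq_bigr (fun i : 'I_n.+1 => f i.+1 *+ 'C(n, i) + f i *+ 'C(n, i)));
    last by move=> i _; rewrite mulrnDl.
  rewrite big_split /=; congr (_ + _).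
  by rewrite [RHS]big_ord_recl bin0 big_ord_recr /= bin_small // mulr0n addr0.
by move=> i _; rewrite /bump /= add1n binS mulrnDr.
Qed.

Lemma Lpoly_convolution n :
  Lpoly n.+1 = \sum_(i < n.+1) (Wpoly i * Lpoly (n - i)) *+ 'C(n, i).
Proof.
elim: n => [|n IHn].
  by rewrite Lpoly_rec big_ord1 /= derivC !mul0r mulr0 mul1r !addr0.
rewrite (sum_binomialS (fun i => Wpoly i * Lpoly (n.+1 - i))).
rewrite Lpoly_rec IHn raddf_sum !mulr_sumr -!big_split.
apply: eq_bigr => -[i lt_in] _ /=; rewrite subSS subSn //.
rewrite Wpoly_rec Lpoly_rec derivMn derivM.
(* The identity holds term by term: the weights [i.+1] from [Wpoly_rec] and [n - i] from [Lpoly_rec]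
   add up to [n.+1], and the derivative terms combine by the product rule. *)
have -> : n.+1%:R = (n - i)%:R + i.+1%:R :> {poly rat}.
  by rewrite -natrD addnS subnK // -ltnS.
move: (n - i)%N 'C(n, i) => m c.
ring.
Qed.

(** * The derivative of a formal exponential *)

Lemma mul_inv_factS n : n.+1%:R * ((n.+1)`!%:R)^-1 = (n`!%:R)^-1 :> rat.
Proof. by rewrite factS natrM invfM mulVKf ?pnatr_eq0. Qed.

Section FormalPowerSeries.
Variable F : fps.

(** Coefficients below [N] of a power depend only on those of [F] below [N], so the power rule for
    polynomials carries over to series. *)
Let trunc N : {poly {poly rat}} := \poly_(i < N) F i.

Lemma coef_trunc_exp N k n : (n < N)%N -> (trunc N ^+ k)`_n = fps_pow F k n.
Proof.
elim: k n => [|k IHk] n lt_nN; first by rewrite expr0 coef1.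
rewrite exprS coefM; apply: eq_bigr => i _.
rewrite coef_poly (leq_ltn_trans _ lt_nN) ?leq_ord // IHk //.
exact: leq_ltn_trans (leq_subr _ _) lt_nN.
Qed.

Lemma fps_powS_deriv k n :
  fps_pow F k.+1 n.+1 *+ n.+1
  = (\sum_(i < n.+1) (F i.+1 *+ i.+1) * fps_pow F k (n - i)%N) *+ k.+1.
Proof.
rewrite -(@coef_trunc_exp n.+2) // -coef_deriv deriv_exp coefMn /= coefM.
congr (_ *+ _); apply: eq_bigr => i _; rewrite coef_deriv coef_poly ltnS ltn_ord.
by rewrite coef_trunc_exp // ltnS (leq_trans (leq_subr _ _)).
Qed.

Hypothesis F0 : F 0%N = 0.

(** A common range of [k] for all coefficients up to [N] allows the sums over [k] and [i] to be
    exchanged in [fps_exp_deriv]. *)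
Lemma fps_exp_widen n N : (n <= N)%N ->
  fps_exp F n = \sum_(k < N.+1) (k`!%:R)^-1 *: fps_pow F k n.
Proof.
move=> le_nN; rewrite /fps_exp.
rewrite (big_ord_widen _ (fun k => (k`!%:R)^-1 *: fps_pow F k n) (le_nN : n < N.+1)%N).
rewrite big_mkcond; apply: eq_bigr => k _; case: ltnP => // lt_nk.
by rewrite fps_pow_coef0 // scaler0.
Qed.

Lemma fps_exp_deriv n :
  fps_exp F n.+1 *+ n.+1
  = \sum_(i < n.+1) (F i.+1 *+ i.+1) * fps_exp F (n - i)%N.
Proof.
(* The term [k = 0] is the constant series 1, whose coefficient at [n.+1] vanishes; each later term
   differentiates to [F'] times its predecessor. *)
rewrite {1}/fps_exp big_ord_recl [fps_pow _ _ _]/(0 : {poly rat}) scaler0 add0r -sumrMnl.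
under [RHS]eq_bigr => i _.
  rewrite (@fps_exp_widen _ n (leq_subr _ _)) mulr_sumr; over.
rewrite exchange_big; apply: eq_bigr => k _.
rewrite scalerMnr.
rewrite [X in _ *: X](fps_powS_deriv k n) -scaler_nat scalerA.
rewrite mulrC mul_inv_factS scaler_sumr.
by apply: eq_bigr => i _; rewrite scalerAr.
Qed.

End FormalPowerSeries.

Theorem theorem2p8 : Lseries =1 fps_exp Wseries.
Proof.
move=> n; have [N] := ubnP n; elim: N n => // N IHN [|n] lt_nN.
  by rewrite /fps_exp big_ord1 /=.
(* Scaling by [n.+1] turns both sides into coefficients of derivatives, which involve only
   coefficients of index at most [n], known by induction. *)
apply: (@scalerI _ _ (n.+1%:R : rat)); first by rewrite pnatr_eq0.
rewrite [RHS]scaler_nat fps_exp_deriv // /Lseries Lpoly_convolution.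
rewrite scalerA mul_inv_factS scaler_sumr; apply: eq_bigr => -[i lt_in] _ /=.
rewrite -IHN /Lseries; last exact: leq_ltn_trans (leq_subr i n) _.
rewrite -[_ *+ i.+1]scaler_nat scalerA mul_inv_factS.
rewrite -scalerAl -scalerAr scalerA -scaler_nat scalerA; congr (_ *: _).
(* What remains is [C(n,i) / n! = 1 / (i! (n-i)!)]. *)
rewrite -(bin_fact (lt_in : i <= n)%N) !natrM !invfM mulrC mulVKf //.
by rewrite pnatr_eq0 -lt0n bin_gt0.
Qed.
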